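(* Let $X$ be a real normed space with topological dual $Y=X^\prime$, and let $C\subseteq X$ be a proper subset. Then $C$ is a norm-open convex cone if and only if there exists a nonempty $\sigma(Y,X)$-compact set $U\subseteq Y$ such that $$C=\{x\in X:\ \forall y\in U,\ \langle x,y\rangle>0\}.$$ In addition, if $V\subseteq Y$ is another nonempty $\sigma(Y,X)$-compact set with the same property (i.e. $C=\{x\in X:\forall y\in V,\ \langle x,y\rangle>0\}$), then $$\overline{\mathrm{co}}(\mathrm{cone}(U))=\overline{\mathrm{co}}(\mathrm{cone}(V)).$$
   Context: Write $\langle x,y\rangle:=y(x)$ for $x\in X$, $y\in Y=X^\prime$. A nonempty subset $C$ of a real vector space is a cone if $\lambda C\subseteq C$ for all real $\lambda>0$. For a nonempty set $S\subseteq Y$, $\mathrm{cone}(S):=\{\lambda y:\lambda>0,\ y\in S\}$, and $\overline{\mathrm{co}}(S)$ denotes the closed convex hull of $S$, the closure being in the weak$^\star$ topology $\sigma(Y,X)$.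
   Formalization: C is taken nonempty, and X is assumed complete for the conclusion that C is norm-open in the ''if'' direction, which fails for some incomplete normed spaces; the other claims hold for every real normed space. *)

(* Defs.v *)
From HB Require Import structures.
From mathcomp Require Import all_boot all_order all_algebra.
From mathcomp Require Import all_classical all_reals all_analysis.

Set Implicit Arguments.
Unset Strict Implicit.
Unset Printing Implicit Defensive.

Import Order.TTheory GRing.Theory Num.Theory.
Import numFieldNormedType.Exports.

Local Open Scope classical_set_scope.
Local Open Scope ring_scope.

Section Dual.
Context {R : realType} (X : normedModType R).

Definition dual_pred : {pred X -> R^o} :=
  fun f => `[< linear f /\ continuous f >].

Lemma dual_pred_submod : submod_closed dual_pred.
Proof.
split.
  apply/asboolP; split; last by move=> x; exact: cvg_cst.
  by move=> a u v; rewrite /= scaler0 addr0.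
move=> a f g /asboolP[fl fc] /asboolP[gl gc]; apply/asboolP; split.
  move=> b u v; rewrite !fctE fl gl !scalerDr !scalerA (mulrC a b).
  by rewrite addrACA.
by move=> x; apply: cvgD; [apply: cvgZr; exact: fc|exact: gc].
Qed.

HB.instance Definition _ :=
  GRing.isSubmodClosed.Build R (X -> R^o) dual_pred dual_pred_submod.

Record dual := Dual { dual_fun :> X -> R^o ; _ : dual_fun \in dual_pred }.

HB.instance Definition _ := [isSub for dual_fun].
HB.instance Definition _ := [Choice of dual by <:].
HB.instance Definition _ := [SubChoice_isSubLmodule of dual by <:].

(* The type [dual] carries the weak-star topology sigma(X', X), that is, the
   topology of pointwise convergence on X, and not the dual norm topology. *)
HB.instance Definition _ := Topological.copy dual
  (initial_topology (dual_fun : dual -> {ptws X -> R^o})).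

End Dual.

Section Cones.
Context {R : realType} (E : lmodType R).

Definition is_cone (C : set E) :=
  C !=set0 /\ forall (l : R) x, 0 < l -> C x -> C (l *: x).

Definition cone_of (S : set E) : set E :=
  [set z | exists l y, [/\ 0 < l, S y & z = l *: y]].

Definition convex_hull (S : set E) : set E := smallest (@convex_set R E) S.

End Cones.

Section WeakStar.
Context {R : realType} (X : normedModType R).

(* The axiom of [completeType] as a proposition on X. On an incomplete space a
   weak-star compact set U need not be norm-bounded, and then
   [positivity_set U] can fail to be open: take the polynomials with the l^1
   norm of the coefficients and U made of p |-> p_0 + n p_n for n : nat. *)
Definition is_complete :=
  forall F : set_system X, ProperFilter F -> cauchy F -> cvg F.

Definition closed_convex_hull (S : set (dual X)) : set (dual X) :=
  closure (convex_hull S).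

Definition positivity_set (U : set (dual X)) : set X :=
  [set x | forall y, U y -> 0 < y x].

End WeakStar.

(* Main.v *)
Require Import Defs.
From HB Require Import structures.
From mathcomp Require Import all_boot all_order all_algebra.
From mathcomp Require Import all_classical all_reals all_analysis.
From mathcomp Require Import ring lra.
Import Order.TTheory GRing.Theory Num.Theory.
Import numFieldNormedType.Exports.
Local Open Scope classical_set_scope.
Local Open Scope ring_scope.

(** For an open convex cone [C] and a point [x0] of [C], the set [U] is a base
    of the dual cone of [C]: the functionals that are nonnegative on [C] and
    take the value 1 at [x0].  A ball around [x0] inside [C] bounds these
    functionals pointwise, so [U] is a closed subset of a product of segments
    and Tychonoff's theorem makes it weak-star compact ([cone_base_compact]).
    Functionals in [U] are positive on the open set [C], and a point outside
    [C] is separated from [C] by a functional that can be normalised at [x0]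
    ([cone_base_spec]).

    Conversely, the positivity set of [U] is plainly a convex cone.  Over a
    complete space a weak-star compact [U] is norm bounded by the uniform
    boundedness principle, and [y |-> y x] attains a positive minimum on [U];
    the two facts together leave room for a ball around [x]
    ([positivity_set_open]).

    For uniqueness, the bipolar theorem ([closure_bipolar]) describes the
    closed convex hull of the cone of [U] through the dual cone
    [{x | forall y, U y -> 0 <= y x}].  Since [C] is nonempty this dual cone
    depends on [C] only: if [x0] is in [C] and [x] in the dual cone then
    [x + t x0] is in [C] for all [t > 0], and [t] can tend to 0
    ([positivity_set_ge0]).

    Both separation arguments rest on one algebraic form of the Hahn-Banach
    theorem, [separating_functional], for convex cones that possess an order
    unit.  Its proof enlarges the cone by Zorn's lemma until it is a half-space
    and reads the functional off the half-space.  For an open cone every point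
    is an order unit; for the bipolar theorem a weak-star neighbourhood that
    involves finitely many points of [X] moves the problem to a space of row
    vectors, where every linear functional is evaluation at a combination of
    these points. *)

(** * Convex cones *)

Section ConvexCones.
Context {R : realType} {E : lmodType R}.
Implicit Types (K M : set E) (l : R) (u x y z : E).

Definition convex_cone K :=
  (forall x y, K x -> K y -> K (x + y)) /\
  (forall l x, 0 < l -> K x -> K (l *: x)).

(** For the preorder with positive cone [K], every vector is below a multiple
    of [u].  This is the algebraic substitute for [u] being interior to [K]. *)
Definition order_unit K u := forall x, exists2 l, 0 < l & K (l *: u - x).

(** Replaces the bundled coefficients and the alias type of convex spaces by
    plain scalars. *)
Lemma convex_setP K : convex_set K <->
  forall l x y, 0 < l < 1 -> K x -> K y -> K (l *: x + (1 - l) *: y).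
Proof.
split=> [Kc l x y /andP[/ltW l0 /ltW l1] Kx Ky|Kc].
  by have /set_mem := Kc x y (Itv01 l0 l1) (mem_set Kx) (mem_set Ky).
apply/convex_setW => x y /set_mem Kx /set_mem Ky l l0 l1.
by apply/mem_set/Kc; rewrite ?l0.
Qed.

Lemma convex_cone_convex_set K : convex_cone K -> convex_set K.
Proof.
move=> [KD Ks]; apply/convex_setP => l x y /andP[l0 l1] Kx Ky.
by apply: KD; apply: Ks; rewrite ?subr_gt0.
Qed.

Lemma is_cone_convex_cone K : is_cone K -> convex_set K -> convex_cone K.
Proof.
move=> [_ Ks] /convex_setP Kc; split=> // x y Kx Ky.
have -> : x + y = 2 *: (2^-1 *: x + (1 - 2^-1) *: y).
  have -> : 1 - 2^-1 = 2^-1 :> R by lra.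
  by rewrite -scalerDr scalerA divff ?scale1r.
by apply: Ks => //; apply: Kc => //; apply/andP; split; lra.
Qed.

End ConvexCones.

(** * Separation by positive functionals *)

Section PositiveFunctional.
Context {R : realType} {E : lmodType R}.
Implicit Types (K M : set E) (l : R) (u x y z : E).

(** Take [M] maximal among the convex cones above [K] that avoid [- u].  If
    neither [x] nor [- x] were in [M], adjoining either of them would produce
    [- u], and a positive combination of these two expressions of [- u]
    cancels [x] and puts [- u] in [M]. *)
Lemma extend_to_half_space K u :
  convex_cone K -> K 0 -> ~ K (- u) ->
  exists M, [/\ convex_cone M, K `<=` M, ~ M (- u) &
    forall x, M x \/ M (- x)].
Proof.
move=> [KD Ks] K0 KNu.
(* The empty set has to satisfy [P], being the union of the empty chain; this
   is why the inclusion of [K] is only asked of nonempty sets. *)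
pose P M := [/\ convex_cone M, ~ M (- u) & M !=set0 -> K `<=` M].
have [F FP Ftot|M [[[MD Ms] MNu KM] Mmax]] := @Zorn_bigcup E P.
  split; first split.
  - move=> x y [A FA Ax] [B FB By].
    have [AB|BA] := Ftot A B FA FB.
      by exists B => //; have [[+ _] _ _] := FP B FB; apply => //; exact: AB.
    by exists A => //; have [[+ _] _ _] := FP A FA; apply => //; exact: BA.
  - move=> l x l0 [A FA Ax]; exists A => //.
    by have [[_ +] _ _] := FP A FA; apply.
  - by move=> [A FA Au]; have [_ + _] := FP A FA.
  - move=> [x [A FA Ax]] k Kk; exists A => //.
    by have [_ _ /(_ _ _ Kk)] := FP A FA; apply; exists x.
have {}KM : K `<=` M.
  have [/KM//|M0] := pselect (M !=set0).
  exfalso; apply: (Mmax K); last by split=> // _ x.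
  split=> [x Mx|KM'].
    by exfalso; apply: M0; exists x.
  by apply: M0; exists 0; exact: KM'.
have adjoin x : ~ M x -> exists m t, [/\ M m, 0 < t & m + t *: x = - u].
  move=> Mx; pose N := [set z | exists m t, [/\ M m, 0 <= t & m + t *: x = z]].
  have [[m [t [Mm]]]|NNu] := pselect (N (- u)).
    rewrite le_eqVlt => /predU1P[<-|t0 mE]; last by exists m, t.
    by rewrite scale0r addr0 => mE; rewrite mE in Mm.
  have MN : M `<=` N by move=> m Mm; exists m, 0; rewrite scale0r addr0.
  exfalso; apply: (Mmax N).
    split=> // /(_ x); apply: contra_not Mx => Nx; apply: Nx.
    by exists 0, 1; rewrite scale1r add0r ler01; split=> //; exact: KM.
  split=> //; last by move=> _; exact: subset_trans MN.
  split=> [_ _ [m [t [Mm t0 <-]]] [m' [t' [Mm' t'0 <-]]]|l _ l0 [m [t [Mm t0 <-]]]].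
    exists (m + m'), (t + t'); rewrite addr_ge0// scalerDl addrACA.
    by split=> //; exact: MD.
  exists (l *: m), (l * t); rewrite mulr_ge0 ?(ltW l0)// scalerDr scalerA.
  by split=> //; exact: Ms.
exists M; split=> // x; apply: contrapT => /not_orP[/adjoin + /adjoin].
move=> [m [t [Mm t0 mE]]] [m' [t' [Mm' t'0 m'E]]]; apply: MNu.
have -> : - u = (t + t')^-1 *: (t' *: m + t *: m').
  have -> : m = - u - t *: x by rewrite -mE addrK.
  have -> : m' = - u + t' *: x by rewrite -m'E scalerN subrK.
  rewrite scalerBr [t *: (_ + _)]scalerDr !scalerA (mulrC t').
  rewrite addrACA [- _ + _]addrC subrr addr0 -scalerDl scalerA.
  rewrite (addrC t') mulVf ?scale1r//.
  by rewrite gt_eqF// addr_gt0.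
apply: (Ms); first by rewrite invr_gt0 addr_gt0.
by apply: MD; exact: Ms.
Qed.

(** The preorder of [M] is total and [u] is an order unit, so each [x] has a
    unique value [a] such that [x] lies between [(a - e) u] and [(a + e) u] for
    all [e > 0].  Uniqueness makes [x |-> a] linear, because the defining
    inequalities can be added, negated and scaled. *)
Lemma half_space_functional M u :
  convex_cone M -> ~ M (- u) -> order_unit M u -> (forall x, M x \/ M (- x)) ->
  exists f : {linear E -> R^o}, f u = 1 /\ forall x, M x -> 0 <= f x.
Proof.
move=> [MD Ms] MNu Mu Mtot.
have Mupos l : M (l *: u) -> 0 <= l.
  move=> Mlu; rewrite leNgt; apply/negP => l0; apply: MNu.
  have -> : - u = (- l)^-1 *: (l *: u).
    by rewrite scalerA invrN mulNr mulVf ?lt_eqF// scaleN1r.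
  by apply: Ms => //; rewrite invr_gt0 oppr_gt0.
have Mu0 l : 0 < l -> M (l *: u).
  have [s s0] := Mu 0; rewrite subr0 => Msu l0.
  have -> : l *: u = (l / s) *: (s *: u) by rewrite scalerA divfK ?gt_eqF.
  by apply: Ms => //; exact: divr_gt0.
pose val x a := forall e, 0 < e -> M (x - (a - e) *: u) /\ M ((a + e) *: u - x).
have val_le x a b : val x a -> val x b -> a <= b.
  move=> xa xb; apply/ler_addgt0Pr => e e0.
  have e20 : 0 < e / 2 by rewrite divr_gt0.
  have := MD _ _ (xa _ e20).1 (xb _ e20).2.
  rewrite addrC subrKA -scalerBl => /Mupos; lra.
have val_inj x a b : val x a -> val x b -> a = b.
  by move=> xa xb; apply/eqP; rewrite eq_le !(val_le x).
have val_ex x : exists a, val x a.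
  pose L := [set s | M (x - s *: u)].
  have L0 : L !=set0.
    have [s s0 Ms'] := Mu (- x); exists (- s).
    by rewrite /L /= scaleNr opprK addrC -(opprK x).
  have Lb : has_ubound L.
    have [s s0 Ms'] := Mu x; exists s => t Lt; rewrite -subr_ge0; apply: Mupos.
    by rewrite scalerBl -(subrKA x); exact: MD.
  exists (sup L) => e e0; split.
    have [s Ls sL] := sup_adherent e0 (conj L0 Lb).
    have -> : x - (sup L - e) *: u = (x - s *: u) + (s - (sup L - e)) *: u.
      by rewrite [(s - _) *: u]scalerBl addrA subrK.
    by apply: MD => //; apply: Mu0; rewrite subr_gt0.
  have [Mx|] := Mtot (x - (sup L + e) *: u); last by rewrite opprB.
  have : sup L + e <= sup L by exact: ub_le_sup.
  lra.
pose f x := xget 0 (val x).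
have fP x : val x (f x) by exact: (xgetPex 0 (val_ex x)).
have fE x a : val x a -> f x = a by exact: val_inj.
have valD x y a b : val x a -> val y b -> val (x + y) (a + b).
  move=> xa yb e e0.
  have e20 : 0 < e / 2 by rewrite divr_gt0.
  have [x1 x2] := xa _ e20; have [y1 y2] := yb _ e20.
  have -> : a + b - e = (a - e / 2) + (b - e / 2) by lra.
  have -> : a + b + e = (a + e / 2) + (b + e / 2) by lra.
  rewrite (scalerDl u (a - _)) (scalerDl u (a + _)) !opprD.
  by split; rewrite addrACA; exact: MD.
have valN x a : val x a -> val (- x) (- a).
  move=> xa e e0; have [x1 x2] := xa _ e0.
  have -> : - a - e = - (a + e) by lra.
  have -> : - a + e = - (a - e) by lra.
  by rewrite !scaleNr !opprK; split; rewrite addrC.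
have valZ l x a : 0 < l -> val x a -> val (l *: x) (l * a).
  move=> l0 xa e e0.
  have el0 : 0 < e / l by rewrite divr_gt0.
  have [x1 x2] := xa _ el0.
  have -> : e = l * (e / l) by rewrite mulrC divfK ?gt_eqF.
  by rewrite -mulrBr -mulrDr -!scalerA -!scalerBr; split; exact: Ms.
have val0 : val 0 0.
  by move=> e e0; rewrite !(sub0r, add0r, subr0) scaleNr opprK; split; exact: Mu0.
have flin : linear (f : E -> R^o).
  move=> l x y; apply: fE; apply: valD => //.
  have [l0|l0|->] := ltgtP l 0; last by rewrite !scale0r.
  - have Nl0 : 0 < - l by rewrite oppr_gt0.
    by have := valN _ _ (valZ _ _ _ Nl0 (fP x)); rewrite scaleNr mulNr !opprK.
  - exact: valZ.
pose g : {linear E -> R^o} :=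
  HB.pack (f : E -> R^o) (GRing.isLinear.Build _ _ _ _ (f : E -> R^o) flin).
exists g; split.
  apply: fE => e e0; rewrite scalerBl scalerDl scale1r opprB addrC subrK.
  by rewrite [u + _]addrC addrK; split; exact: Mu0.
move=> x Mx; rewrite leNgt; apply/negP => fx0.
have fx20 : 0 < - f x / 2 by rewrite divr_gt0 ?oppr_gt0.
have := MD _ _ (fP x _ fx20).2 Mx; rewrite subrK => /Mupos.
by rewrite /g /= in fx0 *; lra.
Qed.

(** Hahn-Banach for cones.  Adjoining [- x] to [K] does not produce [- u]:
    from [k - t x = - u] follows [t x = k + u], which puts [x] in [K].  So the
    enlarged cone extends to a half-space, whose functional is nonnegative at
    [- x]. *)
Lemma separating_functional K u x :
  convex_cone K -> order_unit K u -> ~ K x ->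
  exists f : {linear E -> R^o},
    [/\ f u = 1, forall k, K k -> 0 <= f k & f x <= 0].
Proof.
move=> [KD Ks] Ku Kx.
have Kuu : K u.
  have [s s0] := Ku 0; rewrite subr0 => Ksu.
  have -> : u = s^-1 *: (s *: u) by rewrite scalerA mulVf ?gt_eqF ?scale1r.
  by apply: Ks => //; rewrite invr_gt0.
(* [K] need not contain 0, which the extension to a half-space requires. *)
pose K0 := K `|` [set 0].
have K0D y z : K0 y -> K0 z -> K0 (y + z).
  move=> [Ky|->] [Kz|->]; rewrite ?(addr0, add0r).
  - by left; exact: KD.
  - by left.
  - by left.
  - by right.
have K0s l y : 0 < l -> K0 y -> K0 (l *: y).
  by move=> l0 [Ky|->]; [left; exact: Ks|right; rewrite /= scaler0].
have K0K y z : K0 y -> K z -> K (y + z).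
  by move=> [Ky|->] Kz; rewrite ?add0r//; exact: KD.
pose N := [set y | exists2 t, 0 <= t & K0 (y + t *: x)].
have KN : K `<=` N by move=> k Kk; exists 0; rewrite // scale0r addr0; left.
have [||[t]|M [Mc NM MNu Mtot]] := @extend_to_half_space N u.
- split=> [y z [t t0 Kt] [t' t'0 Kt']|l y l0 [t t0 Kt]].
    by exists (t + t'); rewrite ?addr_ge0// scalerDl addrACA; exact: K0D.
  by exists (l * t); rewrite ?mulr_ge0 ?(ltW l0)// -scalerA -scalerDr; exact: K0s.
- by exists 0; rewrite // scale0r addr0; right.
- rewrite le_eqVlt => /predU1P[<-|t0].
    (* With [- u] in [K0], the order unit makes [K] the whole space. *)
    rewrite scale0r addr0 => Ku'; apply: Kx.
    have [s s0] := Ku (- x); rewrite opprK => Ksx.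
    have -> : x = s *: (- u) + (s *: u + x) by rewrite scalerN addKr.
    by apply: K0K => //; exact: K0s.
  move=> Ktx; apply: Kx.
  have -> : x = t^-1 *: (- u + t *: x + u).
    by rewrite addrAC addNr add0r scalerA mulVf ?gt_eqF ?scale1r.
  by apply: Ks; rewrite ?invr_gt0//; exact: K0K.
have Mu : order_unit M u.
  by move=> y; have [l l0 Kl] := Ku y; exists l => //; exact/NM/KN.
have [f [fu fM]] := half_space_functional _ _ Mc MNu Mu Mtot.
exists f; split=> //; first by move=> k Kk; exact/fM/NM/KN.
suff : 0 <= f (- x) by rewrite linearN oppr_ge0.
by apply/fM/NM; exists 1; rewrite ?ler01// scale1r addNr; right.
Qed.

End PositiveFunctional.

(** * The weak-star topology and the bipolar theorem *)

Section WeakStarTopology.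
Context {R : realType} {X : normedModType R}.
Implicit Types (x : X) (v y : dual X) (A K : set (dual X)).

Lemma dual_linear y : linear (y : X -> R^o).
Proof. by case: y => f /= /asboolP[]. Qed.

Lemma dual_continuous y : continuous (y : X -> R^o).
Proof. by case: y => f /= /asboolP[]. Qed.

Lemma dual_ex (f : {linear X -> R^o}) : continuous f ->
  exists y : dual X, dual_fun y = f :> (X -> R^o).
Proof.
move=> fc; have fP : (f : X -> R^o) \in @dual_pred R X.
  by apply/asboolP; split=> //; exact: linearP.
by exists (Dual fP).
Qed.

HB.instance Definition _ y :=
  GRing.isLinear.Build R X R^o *:%R (dual_fun y) (dual_linear y).

Lemma dualD y y' x : (y + y') x = y x + y' x.
Proof. by []. Qed.

Lemma dualZ (l : R) y x : (l *: y) x = l * y x.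
Proof. by []. Qed.

Lemma dual_evalD y x z : y (x + z) = y x + y z.
Proof. exact: linearD. Qed.

Lemma dual_evalZ y (l : R) x : y (l *: x) = l * y x.
Proof. exact: linearZ. Qed.

Lemma dual_eval_continuous x : continuous (fun y : dual X => y x : R^o).
Proof.
have c1 : continuous (@dual_fun R X : dual X -> {ptws X -> R^o}).
  exact: initial_continuous.
have c2 : continuous ((fun f => f x) : {ptws X -> R^o} -> R^o).
  exact: (@proj_continuous X (fun=> R^o) x).
by move=> y; apply: (continuous_comp (c1 y) (c2 _)).
Qed.

(** The sets on the left generate a filter that converges to [v] at every
    point of [X], hence in the topology of pointwise convergence. *)
Lemma dual_nbhs v A : nbhs v A ->
  exists (s : seq X) (e : R), 0 < e /\
    [set y : dual X | forall x, x \in s -> `|y x - v x| < e] `<=` A.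
Proof.
rewrite nbhsE => -[_ [[G Go <-] Gv] GA].
pose D := [set p : seq X * R | 0 < p.2].
pose B (p : seq X * R) := [set f : X -> R^o | forall x, x \in p.1 -> `|f x - v x| < p.2].
have FB : Filter (filter_from D B).
  apply: filter_from_filter; first by exists ([::], 1) => /=; exact: ltr01.
  move=> [s e] [s' e'] /= e0 e'0; exists (s ++ s', Num.min e e').
    by rewrite /D /= lt_min e0.
  move=> f fB; split=> x xs; have := fB x; rewrite /= mem_cat xs ?orbT lt_min.
    by move=> /(_ isT)/andP[].
  by move=> /(_ isT)/andP[].
have [_ Bv] := @pointwise_cvgP X R^o _ (v : X -> R^o) FB.
have /Bv/(_ G) : forall x, (fun g : X -> R^o => g x) @ filter_from D B --> v x.
  move=> x; apply/cvgrPdist_lt => e e0; exists ([:: x], e) => //= f.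
  by move=> /(_ x); rewrite inE eqxx distrC; apply.
case; first by apply: open_nbhs_nbhs.
move=> [s e] /= e0 BG; exists s, e; split=> // y yB.
by apply: GA; exact: BG.
Qed.

(** A point outside the closure has a basic neighbourhood disjoint from [K],
    given by a list [s] of points and a radius [e].  Evaluation on [s] maps the
    dual to row vectors, where the cone [N] of the differences [k - t w], with
    [t > 0] and [w] within [e] of [v], does not contain 0 and has the order
    unit [- v].  A functional that is nonnegative on [N] is evaluation at a
    combination [x] of the points of [s], and [x] contradicts the
    hypothesis on [v]. *)
Lemma closure_bipolar K v : K !=set0 -> convex_cone K ->
  closure K v <-> forall x, (forall k, K k -> 0 <= k x) -> 0 <= v x.
Proof.
move=> [k0 Kk0] [KD Ks]; split=> [Kv x Kx|vK A /dual_nbhs[s [e [e0 sA]]]].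
  have : closed [set y : dual X | 0 <= y x].
    apply: (@closed_comp _ _ (fun y : dual X => y x : R^o) [set r : R^o | 0 <= r]).
      by move=> y _; exact: dual_eval_continuous.
    exact: closed_ge.
  by apply; apply: closure_subset Kv => k Kk; exact: Kx.
apply: contrapT => noK.
pose n := size s.
pose ev (y : dual X) := \row_(i < n) y s`_i.
pose N := [set w : 'rV[R]_n | exists k (t : R), [/\ K k, 0 < t &
  forall i, `|w 0 i - k s`_i + t * v s`_i| < t * e]].
have Nc : convex_cone N.
  split=> [w w' [k [t [Kk t0 wk]]] [k' [t' [Kk' t'0 wk']]]|l w l0 [k [t [Kk t0 wk]]]].
    exists (k + k'), (t + t'); split; [exact: KD|exact: addr_gt0|move=> i].
    rewrite mxE dualD (mulrDl t t' e).
    rewrite [X in `|X|](_ : _ = (w 0 i - k s`_i + t * v s`_i) +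
      (w' 0 i - k' s`_i + t' * v s`_i)); last by ring.
    exact: le_lt_trans (ler_normD _ _) (ltrD (wk i) (wk' i)).
  exists (l *: k), (l * t); split; [exact: Ks|exact: mulr_gt0|move=> i].
  by rewrite mxE dualZ -!mulrA -mulrBr -mulrDr normrM gtr0_norm// ltr_pM2l.
have N0 : ~ N 0.
  move=> [k [t [Kk t0 wk]]]; apply: noK; exists (t^-1 *: k); split.
    by apply: Ks => //; rewrite invr_gt0.
  apply: sA => x xs.
  have H : `|- k x + t * v x| < t * e.
    have := wk (Ordinal (etrans (index_mem x s) xs)).
    by rewrite mxE /= nth_index// sub0r.
  rewrite dualZ -(ltr_pM2l t0) -{1}(gtr0_norm t0) -normrM.
  rewrite mulrBr mulrA divff ?gt_eqF// mul1r.
  by rewrite distrC addrC.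
have Nu : order_unit N (- ev v).
  move=> w; pose l := (1 + \sum_i `|w 0 i + k0 s`_i|) / e.
  have l0 : 0 < l.
    by rewrite divr_gt0// (lt_le_trans ltr01)// lerDl sumr_ge0.
  exists l => //; exists k0, l; split=> // i.
  rewrite !mxE /l divfK ?gt_eqF// -/l.
  rewrite [X in `|X|](_ : _ = - (w 0 i + k0 s`_i)); last by ring.
  by rewrite normrN ltr_pwDl// (bigD1 i)//= lerDl sumr_ge0.
have [f [fu fN _]] := separating_functional _ _ _ Nc Nu N0.
pose x := \sum_i f (delta_mx 0 i) *: s`_i.
have fE y : f (ev y) = y x.
  rewrite [ev y]row_sum_delta linear_sum /x linear_sum; apply: eq_bigr => i _.
  by rewrite !linearZ mxE; exact: mulrC.
have vx : v x = -1 by rewrite -fu linearN fE opprK.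
(* [k - t v] belongs to [N] for all [t > 0], so [0 <= k x + t]. *)
suff : 0 <= v x by rewrite vx oppr_ge0 ler10.
apply: vK => k Kk; apply/ler_addgt0Pr => t t0.
have : 0 <= f (ev k + t *: (- ev v)).
  apply: fN; exists k, t; split=> // i.
  by rewrite [X in `|X|](_ : _ = 0) ?normr0 ?mulr_gt0// !mxE; ring.
suff -> : f (ev k + t *: (- ev v)) = k x + t by [].
by rewrite linearD linearZ fu fE; congr (_ + _); exact: mulr1.
Qed.

End WeakStarTopology.

(** * Closed convex hulls of cones and positivity sets *)

Section ClosedConvexHull.
Context {R : realType} {X : normedModType R}.
Implicit Types (x : X) (v y : dual X) (U V : set (dual X)) (C : set X).

Lemma cone_of_hull_convex_cone U :
  U !=set0 -> convex_cone (convex_hull (cone_of U)).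
Proof.
move=> [y0 Uy0].
have hullc : convex_set (convex_hull (cone_of U)).
  apply/convex_setP => l y z l01 Hy Hz A [Ac UA].
  by move/convex_setP : (Ac); apply => //; [exact: Hy|exact: Hz].
apply: is_cone_convex_cone => //; split=> [|l y l0 Hy].
  by exists y0 => A [_]; apply; exists 1, y0; rewrite scale1r ltr01.
(* The vectors that [l] scales into the hull form a convex set. *)
apply: (Hy [set z | convex_hull (cone_of U) (l *: z)]).
split=> [|_ [l' [z [l'0 Uz ->]]] A [_ UA]].
  apply/convex_setP => m z z' m01 Hz Hz' /=.
  rewrite scalerDr !scalerA ![l * _]mulrC -!scalerA.
  by move/convex_setP : hullc; apply.
by apply: UA; exists (l * l'), z; rewrite scalerA mulr_gt0.
Qed.

(** The bipolar theorem, the inequalities being needed on [U] only because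
    they pass to cones and convex hulls. *)
Lemma closed_convex_hull_coneP U v : U !=set0 ->
  closed_convex_hull (cone_of U) v <->
  forall x, (forall y, U y -> 0 <= y x) -> 0 <= v x.
Proof.
move=> [y0 Uy0].
have Uhull y : U y -> convex_hull (cone_of U) y.
  by move=> Uy A [_]; apply; exists 1, y; rewrite scale1r ltr01.
have hullU x k : (forall y, U y -> 0 <= y x) ->
    convex_hull (cone_of U) k -> 0 <= k x.
  move=> Ux /(_ [set k | 0 <= k x]); apply; split=> [|_ [l [y [l0 Uy ->]]]]; last first.
    by rewrite /mkset dualZ; apply: mulr_ge0; [exact: ltW|exact: Ux].
  apply/convex_setP => l y z /andP[l0 l1] y0' z0.
  by rewrite /mkset dualD !dualZ addr_ge0 ?mulr_ge0 ?subr_ge0 ?(ltW l0) ?(ltW l1).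
rewrite /closed_convex_hull closure_bipolar; last 2 first.
- by exists y0; exact: Uhull.
- by apply: cone_of_hull_convex_cone; exists y0.
split=> H x Hx; apply: H => y Uy; first exact: (hullU x).
by apply: Hx; exact: Uhull.
Qed.

(** If [x] is nonnegative on [U] and [x0] positive on it, then [x + t x0] is
    positive on [U], hence on [V], for all [t > 0]. *)
Lemma positivity_set_ge0 U V : positivity_set U !=set0 ->
  positivity_set U `<=` positivity_set V ->
  forall x, (forall y, U y -> 0 <= y x) -> forall v, V v -> 0 <= v x.
Proof.
move=> [x0 Cx0] UV x Ux v Vv.
have vx0 : 0 < v x0 by exact: UV.
(* [t = e / v x0] is the multiple of [x0] whose value at [v] is [e]. *)
apply/ler_addgt0Pr => e e0.
have t0 : 0 < e / v x0 by rewrite divr_gt0.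
have /UV/(_ v Vv) : positivity_set U (x + (e / v x0) *: x0).
  move=> y Uy; rewrite dual_evalD dual_evalZ.
  by rewrite ltr_wpDl ?Ux// mulr_gt0// Cx0.
by rewrite dual_evalD dual_evalZ divfK ?gt_eqF// => /ltW.
Qed.

Lemma positivity_set_convex_cone U : convex_cone (positivity_set U).
Proof.
split=> [x z Ux Uz y Uy|l x l0 Ux y Uy].
  by rewrite dual_evalD addr_gt0 ?Ux ?Uz.
by rewrite dual_evalZ mulr_gt0 ?Ux.
Qed.

End ClosedConvexHull.

(** * Openness over a complete space *)

Section OpenPositivitySet.
Context {R : realType} {X : normedModType R}.
Implicit Types (x : X) (y : dual X) (U : set (dual X)).

Lemma dual_bounded_fun_norm y : bounded_fun_norm (dual_fun y : X -> R^o).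
Proof.
have /(_ 0) yc := dual_continuous y.
have := @continuous_linear_bounded R X R^o 0 (dual_fun y) yc.
move=> /linear_boundedP/pinfty_ex_gt0[M M0 yM] r.
by exists (M * r) => x xr; rewrite (le_trans (yM x))// ler_pM2l.
Qed.

(** Weak-star compactness bounds [U] pointwise; the uniform boundedness
    principle makes the bound uniform on the unit ball. *)
Lemma compact_dual_bounded U : is_complete X -> compact U ->
  exists M : R, forall y x, U y -> `|x| <= 1 -> `|y x| <= M.
Proof.
move=> Xc Uc.
pose Xc' : completeNormedModType R := HB.pack X (Uniform_isComplete.Build X Xc).
have [||M MP] := @Banach_Steinhauss R Xc' R^o
  [set (dual_fun y : X -> R^o) | y in U] _ _ 1.
- move=> _ [y Uy <-]; split; last exact: (dual_linear y).
  exact: dual_bounded_fun_norm.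
- move=> x.
  have : compact [set (y x : R^o) | y in U].
    apply: continuous_compact => //.
    apply: continuous_subspaceT; exact: dual_eval_continuous.
  move=> /compact_bounded/pinfty_ex_gt0[M _ MP]; exists M => _ [y Uy <-].
  by apply: MP; exists y.
exists M => y x Uy x1; apply: (MP (dual_fun y)) => //; by exists y.
Qed.

(** With [M] a norm bound for [U] and [d] the minimum of [y x] over [y] in [U],
    the ball of radius [d / (M + 1)] around [x] stays in the positivity set. *)
Lemma positivity_set_open U : is_complete X -> U !=set0 -> compact U ->
  open (positivity_set U).
Proof.
move=> Xc U0 Uc; have [M MP] := compact_dual_bounded _ Xc Uc.
rewrite openE => x Ux.
have [y0 /set_mem Uy0 y0min] : exists2 y0, y0 \in U & forall y, y \in U -> y0 x <= y x.
  apply: (@compact_EVT_min (dual X) R (fun y => y x)) => //.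
  by apply: continuous_subspaceT; exact: dual_eval_continuous.
have d0 : 0 < y0 x by exact: Ux.
have [y1 Uy1] := U0.
have M0 : 0 <= M.
  by apply: le_trans (MP y1 0 Uy1 _); rewrite ?normr0.
have M10 : 0 < M + 1 by rewrite ltr_wpDl.
have r0 : 0 < y0 x / (M + 1) by rewrite divr_gt0.
apply/nbhs_ballP; exists (y0 x / (M + 1)) => // z.
rewrite -ball_normE /= => xz y Uy.
have : `|y (x - z)| < y0 x.
  have [->|nz] := eqVneq (x - z) 0; first by rewrite linear0 normr0.
  have n0 : 0 < `|x - z| by rewrite normr_gt0.
  rewrite -[x - z](scalerKV (lt0r_neq0 n0)) dual_evalZ normrM normr_id.
  have yM : `|y (`|x - z|^-1 *: (x - z))| <= M.
    by apply: MP => //; rewrite normrZ normfV normr_id mulVf ?gt_eqF.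
  rewrite ltr_pdivlMr// in xz; apply: le_lt_trans xz.
  by rewrite ler_pM2l// (le_trans yM)// lerDl.
have -> : y (x - z) = y x - y z by exact: linearB.
by move=> /ltr_normlW; have := y0min y (mem_set Uy); lra.
Qed.

End OpenPositivitySet.

(** * The compact base of the dual of an open cone *)

Section BaseOfOpenCone.
Context {R : realType} {X : normedModType R}.
Implicit Types (x : X) (y : dual X) (C : set X).

(** The weak-star topology is induced by the inclusion of the dual into
    pointwise convergence, so cluster points can be computed there. *)
Lemma compact_dual_fun (U : set (dual X)) :
  compact ([set dual_fun y | y in U] : set {ptws X -> R^o}) -> compact U.
Proof.
move=> Uc F FF FU.
have [_ [[y Uy <-] yF]] := Uc ((@dual_fun R X : dual X -> {ptws X -> R^o}) @ F)
  _ (filterS (@preimage_image _ _ _ _) FU).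
exists y; split=> // A B FA; rewrite nbhsE => -[_ [[G Go <-] Gy] GB].
have [_ [[z Az <-] Gz]] : [set dual_fun z | z in A] `&` G !=set0.
  by apply: yF; [exact: (filterS (@preimage_image _ _ _ _) FA)|exact: open_nbhs_nbhs].
by exists z; split=> //; exact: GB.
Qed.

Lemma nbhs_add_scale C x z : nbhs x C -> exists2 t : R, 0 < t & C (x + t *: z).
Proof.
move=> /nbhs_ballP[e /= e0 xC]; pose t := e / (`|z| + 1).
have z1 : 0 < `|z| + 1 by rewrite ltr_wpDl.
have t0 : 0 < t by rewrite divr_gt0.
exists t => //; apply: xC.
rewrite -ball_normE /= opprD addNKr normrN normrZ gtr0_norm//.
by rewrite /t mulrAC ltr_pdivrMr// ltr_pM2l// ltrDl.
Qed.

Lemma nbhs_order_unit C x0 : convex_cone C -> nbhs x0 C -> order_unit C x0.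
Proof.
move=> [_ Cs] /nbhs_add_scale Cx0 z; have [t t0 Ct] := Cx0 (- z).
exists t^-1; first by rewrite invr_gt0.
have -> : t^-1 *: x0 - z = t^-1 *: (x0 + t *: (- z)).
  by rewrite scalerDr scalerA mulVf ?gt_eqF// scale1r.
by apply: Cs; rewrite ?invr_gt0.
Qed.

(** For [t = e / (2 |x|)] both [x0 + t x] and [x0 - t x] lie in [C], so
    [1 + t (f x)] and [1 - t (f x)] are nonnegative. *)
Lemma positive_functional_bound C x0 (e : R) (f : X -> R^o) :
  0 < e -> ball x0 e `<=` C -> linear f -> f x0 = 1 ->
  (forall c, C c -> 0 <= f c) -> forall x, `|f x| <= 2 / e * `|x|.
Proof.
move=> e0 x0C fl fx0 fC x.
pose g : {linear X -> R^o} := HB.pack f (GRing.isLinear.Build _ _ _ _ f fl).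
have [->|xn0] := eqVneq x 0.
  by rewrite (linear0 g : f 0 = 0) !normr0 mulr0.
have n0 : 0 < `|x| by rewrite normr_gt0.
pose t := e / 2 / `|x|.
have t0 : 0 < t by rewrite !divr_gt0.
have tx (s : R) : `|s| = t -> 0 <= 1 + s * f x.
  move=> st; rewrite -fx0 addrC -[_ + _]/(s *: (f x : R^o) + f x0) -fl.
  apply/fC/x0C; rewrite -ball_normE /= opprD addrCA subrr addr0 normrN normrZ st.
  rewrite /t divfK ?gt_eqF//; lra.
have H1 := tx t (gtr0_norm t0).
have H2 : 0 <= 1 + (- t) * f x by apply: tx; rewrite normrN gtr0_norm.
have -> : 2 / e * `|x| = t^-1 by rewrite /t !invf_div mulrC.
rewrite -[t^-1]mulr1 ler_pdivlMl// -(gtr0_norm t0) -normrM.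
move: H1 H2; rewrite ler_norml mulNr => H1 H2.
by rewrite -subr_ge0 opprK addrC H1 -subr_ge0 H2.
Qed.

Lemma bounded_functional_continuous (f : {linear X -> R^o}) (M : R) :
  (forall x, `|f x| <= M * `|x|) -> continuous f.
Proof.
move=> fM; apply/bounded_linear_continuous/linear_boundedP.
exists M; split=> [|r Mr x]; first exact: num_real.
by rewrite (le_trans (fM x))// ler_wpM2r// ltW.
Qed.

Definition cone_base C x0 : set (dual X) :=
  [set y | y x0 = 1 /\ forall c, C c -> 0 <= y c].

(** Banach-Alaoglu for the base: the bound of [positive_functional_bound] puts
    it in a product of segments, and it makes every linear functional that
    satisfies the closed conditions defining the base continuous. *)
Lemma cone_base_compact C x0 : nbhs x0 C -> compact (cone_base C x0).
Proof.
move=> /nbhs_ballP[e /= e0 x0C].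
have bnd f := @positive_functional_bound C x0 e f e0 x0C.
apply: compact_dual_fun.
pose P (f : X -> R^o) := [/\ linear f, f x0 = 1 & forall c, C c -> 0 <= f c].
have -> : [set dual_fun y | y in cone_base C x0] = [set f | P f].
  apply/seteqP; split=> [_ [y [yx0 yC] <-]|f [fl fx0 fC]].
    by split=> //; exact: dual_linear.
  pose g : {linear X -> R^o} := HB.pack f (GRing.isLinear.Build _ _ _ _ f fl).
  have gc : continuous g.
    exact: (bounded_functional_continuous g _ (bnd f fl fx0 fC)).
  have [y yg] := dual_ex g gc.
  by exists y; rewrite // /cone_base /mkset yg.
have Wc : compact [set f : {ptws X -> R^o} |
    forall x, `[- (2 / e * `|x|), 2 / e * `|x|]%classic (f x)].
  exact: (@tychonoff X (fun=> R^o) (fun x => `[- (2 / e * `|x|), 2 / e * `|x|]%classic)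
    (fun x => @segment_compact R _ _)).
apply: subclosed_compact Wc _; last first.
  move=> f [fl fx0 fC] x /=; rewrite in_itv /= -ler_norml.
  exact: bnd.
have ec x : continuous (fun f : {ptws X -> R^o} => f x : R^o).
  exact: (@proj_continuous X (fun=> R^o) x).
move=> f Pf.
have inS (h : {ptws X -> R^o} -> R^o) (S : set R^o) : continuous h -> closed S ->
    (forall g, P g -> S (h g)) -> S (h f).
  move=> hc Sc PS.
  have : closed (h @^-1` S) by apply: closed_comp => // g _; exact: hc.
  by apply; apply: closure_subset Pf => g /PS.
split.
- move=> l u v; apply/eqP; rewrite -subr_eq0; apply/eqP.
  apply: (inS (fun g => g (l *: u + v) - (l *: g u + g v)) [set 0]).
  + move=> g.
    have c1 := ec (l *: u + v) g; have c2 := ec u g; have c3 := ec v g.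
    have FF := nbhs_filter g.
    exact: (cvgB (FF := FF) c1 (cvgD (FF := FF) (cvgZr (FF := FF) (k := l) c2) c3)).
  + exact: closed_eq.
  + by move=> g [gl _ _]; rewrite /= gl subrr.
- by apply: (inS (fun g => g x0) [set 1]) => [||g []//]; [exact: ec|exact: closed_eq].
- move=> c Cc.
  apply: (inS (fun g => g c) [set r : R^o | 0 <= r]); [exact: ec|exact: closed_ge|].
  by move=> g [_ _]; apply.
Qed.

(** If [x] is in the open set [C] then so is [x - t x0] for some [t > 0], and
    nonnegativity there gives [t <= y x].  If [x] is not in [C], a separating
    functional normalised at [x0] belongs to the base and is not positive at
    [x]. *)
Lemma cone_base_spec C x0 : open C -> convex_cone C -> C x0 ->
  C = positivity_set (cone_base C x0).
Proof.
move=> Co Cc Cx0.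
have nC x : C x -> nbhs x C by move=> Cx; exact: open_nbhs_nbhs.
apply/seteqP; split=> [x Cx y [yx0 yC]|x xC].
  have [t t0 Ct] := nbhs_add_scale C x (- x0) (nC x Cx).
  have := yC _ Ct; rewrite dual_evalD dual_evalZ.
  have -> : y (- x0) = -1 by rewrite -yx0; exact: linearN.
  lra.
apply: contrapT => Cx.
have Cu := nbhs_order_unit C x0 Cc (nC x0 Cx0).
have [f [fx0 fC fx]] := separating_functional _ _ _ Cc Cu Cx.
have fc : continuous f.
  have /nbhs_ballP[e /= e0 x0C] := nC x0 Cx0.
  have bnd := @positive_functional_bound C x0 e f e0 x0C (linearP f) fx0 fC.
  exact: bounded_functional_continuous _ _ bnd.
have [y yf] := dual_ex f fc.
have : 0 < y x by apply: xC; rewrite /cone_base /mkset yf.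
by rewrite yf ltNge fx.
Qed.

(** The positivity set of the empty set is the whole space. *)
Lemma cone_base_nonempty C x0 : open C -> convex_cone C -> C x0 -> C <> setT ->
  cone_base C x0 !=set0.
Proof.
move=> Co Cc Cx0 CT; apply: contrapT => U0; apply: CT.
rewrite (cone_base_spec C x0)//; apply/seteqP; split=> // x _ y Uy.
by exfalso; apply: U0; exists y.
Qed.

End BaseOfOpenCone.

Theorem proposition3p12 (R : realType) (X : normedModType R) (C : set X) :
  C !=set0 -> C <> setT ->
  [/\ [/\ open C, is_cone C & convex_set C] ->
        exists U : set (dual X),
          [/\ U !=set0, compact U & C = positivity_set U],
      (exists U : set (dual X),
          [/\ U !=set0, compact U & C = positivity_set U]) ->
        [/\ is_complete X -> open C, is_cone C & convex_set C]
    & forall U V : set (dual X),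
        [/\ U !=set0, compact U & C = positivity_set U] ->
        [/\ V !=set0, compact V & C = positivity_set V] ->
        closed_convex_hull (cone_of U) = closed_convex_hull (cone_of V)].
Proof.
move=> C0 CT; split.
- move=> [Co Cs Cc]; have [x0 Cx0] := C0.
  have CC := is_cone_convex_cone _ Cs Cc.
  exists (cone_base C x0); split; first exact: cone_base_nonempty.
    by apply: cone_base_compact; exact: open_nbhs_nbhs.
  exact: cone_base_spec.
- move=> [U [U0 Uc CU]].
  have CC : convex_cone C by rewrite CU; exact: positivity_set_convex_cone.
  split; [|by split=> //; exact: CC.2|exact: convex_cone_convex_set].
  by move=> Xc; rewrite CU; exact: positivity_set_open.
- move=> U V [U0 _ CU] [V0 _ CV].
  have UV x : (forall y, U y -> 0 <= y x) <-> (forall y, V y -> 0 <= y x).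
    by split=> H; apply: positivity_set_ge0 H; rewrite -?CU -?CV.
  apply/seteqP; split=> v /closed_convex_hull_coneP Hv;
    by apply/closed_convex_hull_coneP => // x /UV; exact: Hv.
Qed.
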